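(* Let $(p_n)$ be a sequence in $[0,1]$ with $p_n\ge 1-\frac{1}{\sqrt3}(\log n)^{1/n}$. Then the probability that there exist an integer $s$ with $2\le s\le \frac{3^n}{2}$ and a set $S\in C_s$ such that no edge of ${}^3Q^n_{p_n}$ joins $S$ to $V({}^3Q^n)\setminus S$ tends to $0$ as $n\to\infty$.
   Context: For a positive integer $n$, the 3-cube ${}^3Q^n$ is the simple graph with vertex set $V({}^3Q^n)=\{0,1,\dots,3^n-1\}$ in which two vertices are adjacent if and only if their ternary (base 3, $n$-digit) representations differ in exactly one digit; equivalently, it is the Cartesian product of $n$ copies of the complete graph $K_3$. For $p\in[0,1]$, the random subgraph ${}^3Q^n_{p}$ contains all vertices of ${}^3Q^n$ and each edge of ${}^3Q^n$ independently with probability $p$. $C_s$ denotes the family of all $s$-element subsets $S\subseteq V({}^3Q^n)$ such that the subgraph of ${}^3Q^n$ induced on $S$ is connected. Here $\log$ is the natural logarithm. *)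

(* Defs.v *)
From HB Require Import structures.
From mathcomp Require Import all_boot all_order all_algebra.
From mathcomp Require Import all_classical all_reals all_analysis.

Set Implicit Arguments.
Unset Strict Implicit.
Unset Printing Implicit Defensive.

Import Order.TTheory GRing.Theory Num.Theory.
Import numFieldNormedType.Exports.

Local Open Scope ring_scope.

Definition ternary_digit (x i : nat) : nat := ((x %/ 3 ^ i) %% 3)%N.

Definition cube_adj (n : nat) : rel 'I_(3 ^ n) :=
  fun x y => #|[set i : 'I_n | ternary_digit x i != ternary_digit y i]| == 1%N.

(* An undirected edge is the set of its two ends. *)
Definition cube_edges (n : nat) : {set {set 'I_(3 ^ n)}} :=
  [set [set xy.1; xy.2] | xy : 'I_(3 ^ n) * 'I_(3 ^ n) & cube_adj xy.1 xy.2].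

Definition induced_connected (n : nat) (S : {set 'I_(3 ^ n)}) : bool :=
  [forall x in S, forall y in S,
    connect [rel u v | [&& u \in S, v \in S & cube_adj u v]] x y].

Definition connected_sets (n s : nat) : {set {set 'I_(3 ^ n)}} :=
  [set S : {set 'I_(3 ^ n)} | (#|S| == s) && induced_connected S].

(* A spanning subgraph is identified with its edge set H; [cube_prob p A] is
   the probability that the edge set of the random subgraph lies in A. *)
Definition cube_prob (R : realType) (n : nat) (p : R)
    (A : set {set {set 'I_(3 ^ n)}}) : R :=
  \sum_(H in powerset (cube_edges n) | `[< A H >])
    \prod_(e in cube_edges n) (if e \in H then p else 1 - p).

(* These values determine the law: total mass is the case B = set0, and the
   edges are present independently with probability p. *)
Lemma cube_prob_supset (R : realType) (n : nat) (p : R)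
    (B : {set {set 'I_(3 ^ n)}}) : B \subset cube_edges n ->
  cube_prob p (fun H => B \subset H) = p ^+ #|B|.
Proof.
move=> sBE; rewrite /cube_prob; set E := cube_edges n in sBE *.
pose F e : R := if e \in E then p else 0.
pose G e : R := if e \in B then 0 else if e \in E then 1 - p else 1.
transitivity (\prod_e (F e + G e)); last first.
  rewrite -prodr_const [RHS]big_mkcond /=; apply: eq_bigr => e _.
  rewrite /F /G; case: (boolP (e \in B)) => [eB|_].
    by rewrite (fintype.subsetP sBE) // addr0.
  by case: ifP => _; rewrite ?add0r // addrC subrK.
rewrite bigA_distr big_mkcond /=; apply: eq_bigr => H _.
rewrite powersetE asboolb; case: ifPn => [/andP[sHE sBH]|].
  rewrite big_mkcond /=; apply: eq_bigr => e _; rewrite /F /G.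
  have eBH := contraNN (fintype.subsetP sBH e).
  have eHE := contraNN (fintype.subsetP sHE e).
  case: (boolP (e \in E)) => [eE|/eHE eH].
    by case: (boolP (e \in H)) => // /eBH/negbTE->.
  by rewrite (negbTE eH) (negbTE (eBH eH)).
rewrite negb_and => /orP[/fintype.subsetPn[e eH eE]|/fintype.subsetPn[e eB eH]];
  rewrite (bigD1 e) //= /F /G.
  by rewrite eH (negbTE eE) mul0r.
by rewrite (negbTE eH) eB mul0r.
Qed.

(* Main.v *)
(* Put q = 1 - p and N = 3^n; the hypothesis on p gives (3q^2)^n <= n^2. Two
   estimates drive the proof: an s-set of vertices has at least
   2s(n - log_3 s) boundary edges, and at most N(3n)^(2(s-1)) s-sets are
   connected, since each is the support of a closed walk of length 2(s-1).
   A union bound then excludes all sizes 2 <= s <= M, where M is about N^(2/3).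

   It fails for M < s <= N/2. Such an S has at least |S| boundary edges, so at
   least M/n of them lie in a single direction i. Delete direction i: by the
   first part and Markov's inequality, the remaining random graph has few
   components with at most M vertices, hence at most n^4 + N/M components except
   with small probability, and S is a union of components. So S ranges over
   at most 2^(n^4 + N/M) sets determined by the other directions, while the
   boundary edges in direction i are all absent with conditional probability at
   most q^(M/n), which is far smaller than 2^-(n^4 + N/M). *)

Require Import Defs.
From HB Require Import structures.
From mathcomp Require Import all_boot all_order all_algebra.
From mathcomp Require Import all_classical all_reals all_analysis.
From mathcomp Require Import ring lra zify.

Set Implicit Arguments.
Unset Strict Implicit.
Unset Printing Implicit Defensive.
Import Order.TTheory GRing.Theory Num.Theory.
Import numFieldNormedType.Exports.
Local Open Scope ring_scope.

(** * An entropy inequality for three masses *)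

Section Entropy.
Context {R : realType}.
Implicit Types a b c : R.

Lemma ln_tangent (w v : R) : 0 < w -> 0 < v -> ln w + ln v <= v * w - 1.
Proof.
move=> w0 v0; have vw0 := mulr_gt0 v0 w0.
rewrite addrC -lnM ?posrE //.
have := @le_ln1Dx R (v * w - 1); have -> : 1 + (v * w - 1) = v * w by ring.
by apply; lra.
Qed.

(** A gain of [ln 3] times the sum of the pairwise minima, which is [b + 2c] in decreasing order. It
    is the sum of one bound for each of [a], [b], [c]; these supply [2 (b - c) ln 2 + 3 c ln 3], and
    [ln 3 <= 2 ln 2] does the rest. *)
Lemma ternary_entropy a b c : a >= b -> b >= c -> c >= 0 ->
  a * ln a + b * ln b + c * ln c + (b + 2 * c) * ln 3 <= (a + b + c) * ln (a + b + c).
Proof.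
move=> ab bc c0; set s := a + b + c.
have [a0|a0] := leP a 0.
  have a_0 : a = 0 by lra.
  have b_0 : b = 0 by lra.
  have c_0 : c = 0 by lra.
  by rewrite /s a_0 b_0 c_0 !(mul0r, mulr0, addr0).
have s0 : 0 < s by rewrite /s; lra.
have l23 : ln (3 : R) <= 2 * ln 2.
  by rewrite mulr_natl -lnXn // ler_ln ?posrE; lra.
(* The tangent bound for [ln], with equality at [k x = s]; it is used at [k = 1, 2, 3]. *)
have tan (x k : R) : 0 < x -> 0 < k -> s * (ln x + ln k) <= s * ln s + k * x - s.
  move=> x0 k0.
  have := @ln_tangent (x / s) k (divr_gt0 x0 s0) k0.
  rewrite ln_div ?posrE // => /(ler_wpM2l (ltW s0)).
  have -> : s * (k * (x / s) - 1) = k * x - s by field; lra.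
  lra.
(* The weights [a - b], [b - c], [c] on [k = 1, 2, 3] add up to [a], and the weighted sum of [k] is
   exactly [s], so the linear terms cancel. *)
have Ha : a * ln a + (b - c) * ln 2 + c * ln 3 <= a * ln s.
  have := tan _ _ a0 ltr01; have := tan _ _ a0 (ltr0n _ 2); have := tan _ _ a0 (ltr0n _ 3).
  rewrite ln1 => h3 h2 h1; rewrite -(ler_pM2l s0).
  have bc' : 0 <= b - c by lra. have ab' : 0 <= a - b by lra.
  have := ler_wpM2l c0 h3; have := ler_wpM2l bc' h2; have := ler_wpM2l ab' h1.
  rewrite /s; lra.
(* With weights [b - c] and [c] on [k = 2, 3] the linear terms leave [b (b - a)], which is
   nonpositive. *)
have Hb : b * ln b + (b - c) * ln 2 + c * ln 3 <= b * ln s.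
  have [b0|b0] := leP b 0.
    have -> : b = 0 by lra.
    have -> : c = 0 by lra.
    by rewrite !mul0r subrr mul0r !addr0.
  have := tan _ _ b0 (ltr0n _ 2); have := tan _ _ b0 (ltr0n _ 3).
  move=> h3 h2; rewrite -(ler_pM2l s0).
  have bc' : 0 <= b - c by lra.
  have := ler_wpM2l c0 h3; have := ler_wpM2l bc' h2.
  have : 0 <= b * (a - b) by apply: mulr_ge0; lra.
  rewrite /s; lra.
have Hc : c * ln c + c * ln 3 <= c * ln s.
  have [c0'|c0'] := leP c 0.
    have -> : c = 0 by lra.
    by rewrite !mul0r addr0.
  rewrite -mulrDr ler_wpM2l // -lnM ?posrE // ler_ln ?posrE //; rewrite /s; lra.
have : 0 <= (b - c) * (2 * ln 2 - ln 3) by apply: mulr_ge0; lra.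
have -> : s * ln s = a * ln s + b * ln s + c * ln s by rewrite /s; ring.
lra.
Qed.
End Entropy.

(** * Vertices as digit strings, and their layers in one direction *)

Section Digits.
Local Open Scope nat_scope.

Lemma ternary_digit_inj n x y : x < 3 ^ n -> y < 3 ^ n ->
  (forall i, i < n -> ternary_digit x i = ternary_digit y i) -> x = y.
Proof.
elim: n x y => [|n IHn] x y; first by rewrite !ltnS !leqn0 => /eqP-> /eqP->.
move=> xn yn xy.
have lt3 z : z < 3 ^ n.+1 -> z %/ 3 < 3 ^ n by rewrite ltn_divLR // -expnSr.
rewrite (divn_eq x 3) (divn_eq y 3); congr (_ * 3 + _).
  apply: IHn => [||i lti]; [exact: lt3 | exact: lt3 |].
  by rewrite /ternary_digit -!divnMA -expnS; apply: xy.
by have := xy 0 isT; rewrite /ternary_digit expn0 !divn1.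
Qed.

Variable n : nat.
Notation V := 'I_(3 ^ n).
Implicit Types (x y : V) (i j : 'I_n) (d : 'I_3) (S : {set V}) (I : {set 'I_n}).

Definition digit x i : 'I_3 := inZp (ternary_digit x i).

Lemma val_digit x i : digit x i = ternary_digit x i :> nat.
Proof. by rewrite /= modn_mod. Qed.

Definition digits x : {ffun 'I_n -> 'I_3} := [ffun i => digit x i].

Lemma digits_inj : injective digits.
Proof.
move=> x y /ffunP xy; apply/val_inj.
apply: (@ternary_digit_inj n); [exact: ltn_ord | exact: ltn_ord |] => i lti.
by rewrite -!(val_digit _ (Ordinal lti)); have := xy (Ordinal lti); rewrite !ffunE => ->.
Qed.

Lemma digits_bij : bijective digits.
Proof.
by apply: (inj_card_bij digits_inj); rewrite card_ffun !card_ord.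
Qed.

Lemma set_digit_subproof x i d :
  {y | digits y = [ffun j => if j == i then d else digit x j]}.
Proof.
apply: cid; have [g gK Kg] := digits_bij.
by exists (g [ffun j => if j == i then d else digit x j]); rewrite Kg.
Qed.

(** Neighbours are reached by overwriting one digit. The new vertex comes from the bijection with
    digit strings, which avoids arithmetic with powers of 3. *)
Definition set_digit x i d : V := projT1 (set_digit_subproof x i d).

Lemma digit_set x i d j :
  digit (set_digit x i d) j = if j == i then d else digit x j.
Proof.
rewrite /set_digit; case: set_digit_subproof => y /= /ffunP/(_ j).
by rewrite !ffunE.
Qed.

Lemma digit_inj x y : (forall i, digit x i = digit y i) -> x = y.
Proof. by move=> xy; apply/digits_inj/ffunP => i; rewrite !ffunE. Qed.

Lemma set_digit_id x i : set_digit x i (digit x i) = x.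
Proof. by apply: digit_inj => j; rewrite digit_set; case: eqP => // ->. Qed.

Lemma set_digitK x i d : set_digit (set_digit x i d) i (digit x i) = x.
Proof.
by apply: digit_inj => j; rewrite !digit_set; case: eqP => // ->.
Qed.

Lemma set_digit_neq x i d : set_digit x i d != x -> d != digit x i.
Proof. by apply: contraNneq => ->; rewrite set_digit_id. Qed.

Lemma cube_adjP x y :
  reflect (exists i, exists2 d, d != digit x i & y = set_digit x i d) (cube_adj x y).
Proof.
have diffE i : (ternary_digit x i != ternary_digit y i) = (digit x i != digit y i).
  by rewrite -!val_digit.
rewrite /cube_adj; apply: (iffP cards1P) => [[i /setP xy]|[i [d dx ->]]].
  have xyi j : (digit x j != digit y j) = (j == i).
    by have := xy j; rewrite !inE diffE.
  exists i, (digit y i); first by rewrite eq_sym xyi.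
  apply: digit_inj => j; rewrite digit_set; case: eqP => [->//|/eqP ji].
  by apply/esym/eqP; rewrite -[_ == _]negbK xyi.
exists i; apply/setP => j; rewrite !inE.
have -> : (ternary_digit x j != ternary_digit (set_digit x i d) j) =
  (digit x j != digit (set_digit x i d) j) by rewrite -!val_digit.
rewrite digit_set; case: (eqVneq j i) => [->|]; first by rewrite eq_sym.
by rewrite eqxx.
Qed.

(* The inner sum includes the trivial choice [d = digit x i], so that
   [stays i S = #|S| +] the inner degrees of [S] in direction [i]. *)
Definition stays i S : nat := \sum_(x in S) \sum_d (set_digit x i d \in S).

Definition layer i S d := [set x in S | digit x i == d].

Lemma sum_layer i S (F : V -> nat) :
  \sum_(x in S) F x = \sum_d \sum_(x in layer i S d) F x.
Proof.
rewrite (partition_big (fun x => digit x i) predT) //=.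
by apply: eq_bigr => d _; apply: eq_bigl => x; rewrite inE.
Qed.

Lemma card_layers i S : #|S| = \sum_d #|layer i S d|.
Proof.
by rewrite -sum1_card (sum_layer i); apply: eq_bigr => d _; rewrite sum1_card.
Qed.

(** Changing digit [j] does not move a vertex out of its layer in direction [i]. *)
Lemma stays_layers i j S : j != i -> stays j S = \sum_d stays j (layer i S d).
Proof.
move=> ji; rewrite /stays (sum_layer i); apply: eq_bigr => d _.
apply: eq_bigr => x; rewrite inE => /andP[xS xd]; apply: eq_bigr => d' _.
by rewrite inE digit_set [i == j]eq_sym (negbTE ji) xd andbT.
Qed.

(** Overwriting digit [i] by [d'] is injective on layer [d], and those images that lie in [S] lie in
    layer [d']; hence the minimum of the two sizes. *)
Lemma stays_cross i S :
  stays i S <= \sum_d \sum_d' minn #|layer i S d| #|layer i S d'|.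
Proof.
rewrite /stays (sum_layer i); apply: leq_sum => d _.
rewrite exchange_big /=; apply: leq_sum => d' _.
rewrite -big_mkcondr /= sum1_card leq_min.
set A := [set x in layer i S d | set_digit x i d' \in S].
rewrite (_ : #|_| = #|A|); last by apply: eq_card => x; rewrite [in RHS]inE.
apply/andP; split.
  by apply/subset_leq_card/fintype.subsetP => x; rewrite inE => /andP[].
rewrite -(@card_in_imset _ _ (fun x => set_digit x i d')).
  apply/subset_leq_card/fintype.subsetP => _ /imsetP[x xA ->]; move: xA.
  by rewrite !inE digit_set eqxx => /andP[_ ->]; rewrite eqxx.
move=> x y; rewrite !inE => /andP[/andP[_ /eqP xd] _] /andP[/andP[_ /eqP yd] _] xy.
by rewrite -(set_digitK x i d') xd xy -yd set_digitK.
Qed.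

End Digits.

(** * The edge-isoperimetric inequality *)

Section Isoperimetry.
Context {R : realType}.

(** Pairwise minima make the inequality symmetric, so the three numbers may be sorted. *)
Lemma ternary_entropy_min (a b c : nat) :
  a%:R * ln a%:R + b%:R * ln b%:R + c%:R * ln c%:R +
    (minn a b + minn a c + minn b c)%:R * ln 3
    <= (a + b + c)%:R * ln (a + b + c)%:R :> R.
Proof.
wlog ab : a b c / (b <= a)%N => [H|].
  have /orP[|ab] := leq_total b a; first exact: H.
  have := H b a c ab.
  rewrite (_ : b + a = a + b)%N; last by lia.
  rewrite (_ : minn b a + _ + _ = minn a b + minn a c + minn b c)%N; last by lia.
  lra.
wlog bc : a b c ab / (c <= b)%N => [H|].
  have /orP[|bc] := leq_total c b; first exact: H.
  have /orP[ac|ca] := leq_total c a.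
    have := H a c b ac bc.
    rewrite (_ : a + c + b = a + b + c)%N; last by lia.
    rewrite (_ : minn a c + _ + _ = minn a b + minn a c + minn b c)%N; last by lia.
    lra.
  have := H c a b ca ab.
  rewrite (_ : c + a + b = a + b + c)%N; last by lia.
  rewrite (_ : minn c a + _ + _ = minn a b + minn a c + minn b c)%N; last by lia.
  lra.
have -> : (minn a b + minn a c + minn b c)%:R = b%:R + 2 * c%:R :> R.
  by rewrite (minn_idPr ab) (minn_idPr bc) (minn_idPr (leq_trans bc ab)) !natrD; ring.
by rewrite !natrD; apply: ternary_entropy; rewrite ?ler_nat ?ler0n.
Qed.

Variable n : nat.
Notation V := 'I_(3 ^ n).
Implicit Types (x y : V) (i j : 'I_n) (d : 'I_3) (S : {set V}) (I : {set 'I_n}).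

(** Induction on the directions: split [S] into its three layers in the first direction and apply
    the induction hypothesis to each. The first direction itself contributes [#|S|] plus twice the
    pairwise minima of the layer sizes, which the entropy inequality absorbs. *)
Lemma stays_bound (I : seq 'I_n) S : uniq I ->
  (\sum_(i <- I) stays i S)%:R * ln 3 <=
    (size I * #|S|)%:R * ln 3 + 2 * (#|S|%:R * ln #|S|%:R) :> R.
Proof.
have ln3 : 0 <= ln 3 :> R by rewrite ln_ge0 // ler1n.
elim: I S => [|i I IHI] S /=.
  rewrite big_nil !mul0r add0r mulr_ge0 // mulr_ge0 //.
  (* The empty set relies on the default value [ln 0 = 0]. *)
  by case: #|S| => [|k]; [rewrite ln0 | rewrite ln_ge0 // ler1n].
case/andP=> iI uI; rewrite big_cons.
have -> : (\sum_(j <- I) stays j S = \sum_d \sum_(j <- I) stays j (layer i S d))%N.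
  rewrite [RHS]exchange_big /= big_seq [RHS]big_seq; apply: eq_bigr => j jI.
  by apply: stays_layers; apply: contraNneq iI => <-.
rewrite natrD mulrDl natr_sum mulr_suml.
have le1 := @ler_sum _ _ (index_enum 'I_3) predT _ _ (fun d _ => IHI (layer i S d) uI).
have le0 := ler_wpM2r ln3 (etrans (ler_nat _ _ _) (stays_cross i S)).
apply: (le_trans (lerD le0 le1)).
rewrite (card_layers i S) !big_ord_recl !big_ord0.
set a := #|layer i S _|; set b := #|layer i S _|; set c := #|layer i S _|.
rewrite !minnn (minnC b a) (minnC c a) (minnC c b) !addn0 !addr0.
have := ternary_entropy_min a b c; rewrite /=.
rewrite !addnA !(mulSn, natrD, natrM); lra.
Qed.

(** Indexing boundary edges by inner end, direction and new digit makes the parametrisation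
    injective, which is what allows them to be counted. *)
Definition cut I S : {set {set V}} :=
  [set [set t.1.1; set_digit t.1.1 t.1.2 t.2] | t : V * 'I_n * 'I_3 &
    [&& t.1.1 \in S, t.1.2 \in I & set_digit t.1.1 t.1.2 t.2 \notin S]].

Lemma cutP I S e :
  reflect (exists x i d, [/\ x \in S, i \in I, set_digit x i d \notin S &
                          e = [set x; set_digit x i d]]) (e \in cut I S).
Proof.
apply: (iffP imsetP) => [[[[x i] d]]|[x [i [d [xS iI yS ->]]]]].
  by rewrite inE /= => /and3P[xS iI yS ->]; exists x, i, d.
by exists (x, i, d) => //; rewrite inE /= xS iI yS.
Qed.

Lemma set_digit_inj x i d j d' : set_digit x i d != x ->
  set_digit x i d = set_digit x j d' -> i = j /\ d = d'.
Proof.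
move=> /set_digit_neq dx xx.
have := digit_set x i d i; rewrite xx digit_set eqxx.
by case: eqP => [-> ->//|_ dE]; rewrite dE eqxx in dx.
Qed.

Lemma set2_eq (T : finType) (x y x' y' : T) : [set x; y] = [set x'; y'] ->
  (x = x' /\ y = y') \/ (x = y' /\ y = x').
Proof.
move=> /setP E; have := E x; have := E y; have := E x'; have := E y'.
rewrite !inE !eqxx /= ?orbT => /orP y'xy /orP x'xy /esym/orP yxy /esym/orP xxy.
case: xxy y'xy x'xy yxy => /eqP->; [left | right]; split=> //;
  by case: yxy => /eqP yE //; case: y'xy; case: x'xy => /eqP + /eqP; rewrite yE; congruence.
Qed.

(** Each vertex of [S] and each direction in [I] have three choices of digit, the trivial one
    included, and every choice either stays in [S] or gives one boundary edge. *)
Lemma card_cut I S :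
  (#|cut I S| + \sum_(i in I) stays i S = #|I| * (3 * #|S|))%N.
Proof.
rewrite card_in_imset; last first.
  move=> [[x i] d] [[x' i'] d']; rewrite !inE /= => /and3P[xS iI yS] /and3P[xS' iI' yS'].
  case/set2_eq => [[xx yy]|[xx _]]; last by rewrite -xx xS in yS'.
  subst x'; have : set_digit x i d != x by apply: contraNneq yS => ->.
  by move/set_digit_inj => /(_ _ _ yy)[-> ->].
have -> : #|[set t : V * 'I_n * 'I_3 | [&& t.1.1 \in S, t.1.2 \in I &
    set_digit t.1.1 t.1.2 t.2 \notin S]]| =
    (\sum_(i in I) \sum_(x in S) \sum_d (set_digit x i d \notin S))%N.
  rewrite -sum1_card exchange_big /= pair_big /=.
  rewrite pair_big_dep /= big_mkcond [RHS]big_mkcond /=; apply: eq_bigr => t _.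
  by rewrite inE; do 3!case: (_ \in _).
rewrite -big_split /= -sum1_card big_distrl /=; apply: eq_bigr => i iI.
rewrite /stays -big_split /= mul1n mulnC -sum_nat_const; apply: eq_bigr => x _.
rewrite -big_split /= -[RHS]card_ord -sum1_card; apply: eq_bigr => d _.
by case: (_ \in S).
Qed.

(** Subtract the bound [|I| |S| + 2 |S| log_3 |S|] on the choices that stay from the total
    [3 |I| |S|]. Multiplying by [ln 3] avoids logarithms to base 3. *)
Lemma edge_isoperimetry I S :
  2 * #|S|%:R * (#|I|%:R * ln 3 - ln #|S|%:R) <= #|cut I S|%:R * ln 3 :> R.
Proof.
have := stays_bound S (enum_uniq (mem I)).
rewrite big_enum -cardE /= => st.
have := congr1 (fun k => k%:R * ln 3 : R) (card_cut I S).
rewrite natrD mulrDl !natrM.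
move: st; rewrite natrM; lra.
Qed.

End Isoperimetry.

(** * Closed walks through a connected set *)

Section ClosedWalks.
Variables (T : finType) (e : rel T).
Implicit Types (S A : {set T}).

Lemma connect_exit (r : rel T) A x y : x \in A -> y \notin A -> connect r x y ->
  exists u v, [/\ u \in A, v \notin A & r u v].
Proof.
move=> xA yA /connectP[p]; elim: p x xA => [|z p IHp] x xA /=.
  by move=> _ yx; rewrite yx xA in yA.
case/andP=> xz zp yE; have [zA|zA] := boolP (z \in A); first exact: IHp zA zp yE.
by exists x, z.
Qed.

(** Induction on [k]: a detour from a visited [u] to an unvisited neighbour [v] and back adds two
    steps and a new vertex. *)
Lemma closed_walk S x k : symmetric e -> x \in S ->
  {in S &, forall y z, connect [rel u v | [&& u \in S, v \in S & e u v]] y z} ->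
  (k < #|S|)%N ->
  exists p, [/\ size p = k.*2, path e x p, last x p = x,
    [set z in x :: p] \subset S & (k < #|[set z in x :: p]|)%N].
Proof.
move=> esym xS Sconn; elim: k => [|k IHk] kS.
  exists [::]; split=> //; last by apply/card_gt0P; exists x; rewrite !inE.
  by apply/fintype.subsetP => z; rewrite !inE => /eqP->.
have [p [szp pp lastp pS kp]] := IHk (ltnW kS).
(* If the walk already meets enough vertices, a back-and-forth step at [x] only adjusts its length;
   otherwise some vertex of [S] is still unvisited. *)
have [kp'|kp'] := ltnP k.+1 #|[set z in x :: p]|.
  have x_in : x \in x :: p by rewrite inE eqxx.
  have : exists2 y, y \in S & e x y.
    have [y yS yx] : exists2 y, y \in S & y \notin [set x].
      apply/subsetPn; apply: contraL kS => /subset_leq_card.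
      by rewrite cards1 -leqNgt => /leq_trans; apply.
    have [u [v [+ vx /and3P[_ vS uv]]]] := connect_exit (set11 x) yx (Sconn _ _ xS yS).
    by rewrite inE => /eqP ux; rewrite ux in uv; exists v.
  case=> y yS xy; exists [:: y, x & p]; split => //=.
  - by rewrite szp.
  - by rewrite xy esym xy.
  - apply/fintype.subsetP => z; rewrite !inE => /or3P[/eqP->|/eqP->|] //.
    by rewrite -in_cons => zp; apply: (fintype.subsetP pS); rewrite inE.
  apply: leq_trans kp' _; apply/subset_leq_card/fintype.subsetP => z; rewrite !inE.
  by case/orP=> ->; rewrite !orbT.
have [v0 v0S v0p] : exists2 v, v \in S & v \notin [set z in x :: p].
  apply/subsetPn; apply: contraL kS => /subset_leq_card/leq_trans/(_ kp').
  by rewrite -leqNgt.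
have x_in : x \in [set z in x :: p] by rewrite inE in_cons eqxx.
have [u [v [up vp /and3P[uS vS uv]]]] := connect_exit x_in v0p (Sconn _ _ xS v0S).
rewrite inE in up; case/splitPl: up szp pp lastp pS kp kp' vp x_in v0p.
move=> p1 p2 lastp1; rewrite size_cat cat_path last_cat lastp1 => szp /andP[pp1 pp2] lastp.
move=> pS kp _ vp _ _.
exists (p1 ++ [:: v, u & p2]); split.
- by rewrite size_cat /= !addnS szp.
- by rewrite cat_path pp1 lastp1 /= uv esym uv.
- by rewrite last_cat /=.
- apply/fintype.subsetP => z; rewrite inE in_cons mem_cat !in_cons.
  have := fintype.subsetP pS z; rewrite inE in_cons mem_cat => zS.
  case/or3P=> [zx|zp|]; [by apply: zS; rewrite zx | by apply: zS; rewrite zp orbT|].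
  by case/or3P=> [/eqP->|/eqP->|zp] //; apply: zS; rewrite zp !orbT.
apply: (@leq_trans #|v |: [set z in x :: p1 ++ p2]|).
  by rewrite cardsU1 vp.
apply/subset_leq_card/fintype.subsetP => z; rewrite !inE !mem_cat !in_cons.
by case/orP=> [->|/or3P[->|->|->]]; rewrite ?orbT.
Qed.

End ClosedWalks.

(** * Counting connected vertex sets *)

Section CountConnected.
Local Open Scope nat_scope.
Variable n : nat.
Notation V := 'I_(3 ^ n).

Lemma cube_adj_sym : symmetric (@cube_adj n).
Proof.
move=> x y; rewrite /cube_adj; congr (_ == 1); apply: eq_card => i.
by rewrite !inE eq_sym.
Qed.

(** A connected set is recovered from the start of a covering closed walk and its [2(s-1)] moves. A
    move is a direction and a digit, so there are [3n] codes, trivial moves included. *)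
Lemma card_connected_sets s : 0 < s ->
  #|connected_sets n s| <= 3 ^ n * (n * 3) ^ (s.-1).*2.
Proof.
move=> s0.
pose step (z : V) (t : 'I_n * 'I_3) := set_digit z t.1 t.2.
pose walk (xt : V * (s.-1).*2.-tuple ('I_n * 'I_3)) :=
  [set z in xt.1 :: scanl step xt.1 xt.2].
have -> : 3 ^ n * (n * 3) ^ (s.-1).*2 = #|{: V * (s.-1).*2.-tuple ('I_n * 'I_3)}|.
  by rewrite card_prod card_tuple card_prod !card_ord.
apply: leq_trans (leq_imset_card walk _).
apply/subset_leq_card/fintype.subsetP => S; rewrite inE => /andP[/eqP Ss Sconn].
have [x xS] : exists x, x \in S by apply/card_gt0P; rewrite Ss.
have Sc : {in S &, forall y z,
    connect [rel u v | [&& u \in S, v \in S & cube_adj u v]] y z}.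
  by move=> y z yS zS; exact: (forall_inP (forall_inP Sconn y yS) z zS).
have kS : s.-1 < #|S| by rewrite Ss prednK.
have [p [szp pp _ pS kp]] := closed_walk cube_adj_sym xS Sc kS.
have [ts [szts pE]] : exists ts, size ts = size p /\ p = scanl step x ts.
  elim: p x {szp pS kp xS} pp => [|y p IHp] x /=; first by exists [::].
  case/andP=> /cube_adjP[i [d _ yE]] /IHp[ts [szts pE]].
  by exists ((i, d) :: ts); rewrite /= szts -![step x (i, d)]/(set_digit x i d) -yE -pE.
have szt : size ts == (s.-1).*2 by rewrite szts szp.
apply/imsetP; exists (x, Tuple szt) => //.
(* The visited set lies in [S] and has at least [s] elements, so it is [S]. *)
rewrite /walk /= -pE; apply/esym/eqP; rewrite eqEcard pS Ss.
by rewrite prednK in kp.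
Qed.

End CountConnected.

(** * Components and closed sets of a finite graph *)

Section Components.
Local Open Scope nat_scope.
Variables (T : finType) (e : rel T).
Hypothesis e_sym : symmetric e.

Definition component x := [set y | connect e x y].
Definition components := [set component x | x : T].

Lemma component_eq x y : y \in component x -> component y = component x.
Proof.
have cs := sym_connect_sym e_sym.
rewrite inE => xy; apply/setP => z; rewrite !inE.
by rewrite (same_connect cs xy).
Qed.

(** A closed set is the union of the components it contains, so the set of these components
    determines it. *)
Lemma card_closed_sets :
  #|[set S : {set T} | [forall x in S, forall y, e x y ==> (y \in S)]]|
    <= 2 ^ #|components|.
Proof.
rewrite -card_powerset -(@card_in_imset _ _ (fun S : {set T} =>
  [set C in components | C \subset S])).
  apply/subset_leq_card/fintype.subsetP => _ /imsetP[S _ ->].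
  by rewrite powersetE; apply/fintype.subsetP => C; rewrite inE => /andP[].
have coverE (S : {set T}) : [forall x in S, forall y, e x y ==> (y \in S)] ->
    S = \bigcup_(C in [set C in components | C \subset S]) C.
  move=> Scl; apply/setP => x; apply/idP/bigcupP => [xS|[C]]; last first.
    by rewrite inE => /andP[_ /fintype.subsetP]; apply.
  exists (component x); last by rewrite inE connect0.
  rewrite inE imset_f //=; apply/fintype.subsetP => y; rewrite inE.
  case/connectP=> p; elim: p x xS => [|z p IHp] x xS /=; first by move=> _ ->.
  case/andP=> xz zp; apply: IHp zp.
  by have /implyP := forallP (forall_inP Scl x xS) z; apply.
move=> S1 S2; rewrite !inE => /coverE E1 /coverE E2 E12.
by rewrite E1 E2 E12.
Qed.

(** Components are disjoint, so those with more than [M] elements use up at least [M] elements of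
    [T] each. *)
Lemma card_components M :
  #|components| * M <= #|[set C in components | #|C| <= M]| * M + #|T|.
Proof.
rewrite -(cardsID [set C : {set T} | #|C| <= M] components) mulnDl leq_add //.
  by rewrite leq_mul2r; apply/orP; right; apply/subset_leq_card/fintype.subsetP => C;
     rewrite !inE.
set P := _ :\: _.
have trivP : finset.trivIset P.
  apply: (finset.trivIsetS (finset.subsetDl _ _)); apply/finset.trivIsetP.
  move=> _ _ /imsetP[x _ ->] /imsetP[y _ ->].
  apply: contraNT => /pred0Pn[z /andP[/= xz yz]].
  by rewrite -(component_eq xz) (component_eq yz).
apply: leq_trans (max_card (mem (finset.cover P))); move/eqP: trivP => <-.
rewrite -sum_nat_const; apply: leq_sum => C; rewrite !inE -ltnNge => /andP[/ltnW].
by [].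
Qed.

End Components.

(** * Expectation over a random edge set, and independence *)

Section Expectation.
Context {R : realType}.
Variables (T : finType) (E : {set T}) (p : R).
Hypothesis p01 : 0 <= p <= 1.
Implicit Types (H F : {set T}) (f g : {set T} -> R).

Definition weight H : R := \prod_(e in E) (if e \in H then p else 1 - p).

Definition expect f : R := \sum_(H in powerset E) weight H * f H.

Lemma weight_ge0 H : 0 <= weight H.
Proof.
case/andP: p01 => p0 p1; apply: prodr_ge0 => e _.
by case: ifP => // _; rewrite subr_ge0.
Qed.

Lemma expect_le f g : (forall H, H \subset E -> f H <= g H) -> expect f <= expect g.
Proof.
move=> fg; apply: ler_sum => H; rewrite powersetE => HE.
by rewrite ler_wpM2l ?weight_ge0 ?fg.
Qed.

Lemma eq_expect f g : f =1 g -> expect f = expect g.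
Proof. by move=> fg; apply: eq_bigr => H _; rewrite fg. Qed.

Lemma expectD f g : expect (fun H => f H + g H) = expect f + expect g.
Proof. by rewrite -big_split; apply: eq_bigr => H _; rewrite mulrDr. Qed.

Lemma expect_sum (I : finType) (P : pred I) (F : I -> {set T} -> R) :
  expect (fun H => \sum_(i | P i) F i H) = \sum_(i | P i) expect (F i).
Proof.
by rewrite exchange_big; apply: eq_bigr => H _; rewrite mulr_sumr.
Qed.

Lemma expectZ c f : expect (fun H => c * f H) = c * expect f.
Proof. by rewrite /expect mulr_sumr; apply: eq_bigr => H _; rewrite mulrCA. Qed.

(** Pair each [H] avoiding [e] with [e |: H]: [f] takes the same value on both, and the factors
    [1 - p] and [p] of [e] add up to 1. *)
Lemma expect_avoid1 f e : e \in E -> (forall H, f (H :\ e) = f H) ->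
  expect (fun H => f H * (e \notin H)%:R) = expect f * (1 - p).
Proof.
move=> eE fe; pose g H : R := \prod_(e' in E :\ e) (if e' \in H then p else 1 - p).
have wE H : weight H = (if e \in H then p else 1 - p) * g H.
  rewrite /weight (bigD1 e) //=; congr (_ * _).
  by apply: eq_bigl => e'; rewrite !inE andbC.
have wN : expect (fun H => f H * (e \notin H)%:R) =
    (1 - p) * \sum_(H in powerset E | e \notin H) g H * f H.
  rewrite mulr_sumr [LHS]/expect big_mkcondr /=; apply: eq_bigr => H _.
  by rewrite wE; case: (e \in H); rewrite ?mulr0 // mulr1 mulrA.
rewrite wN mulrC; congr (_ * _); rewrite /expect.
rewrite [RHS](bigID (fun H => e \in H)) /=.
rewrite [X in _ = X + _](reindex_onto (fun H => e |: H) (fun H => H :\ e)) /=; last first.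
  by move=> H /andP[_ eH]; rewrite finset.setD1K.
rewrite [X in _ = X + _](eq_bigl (fun H => (H \in powerset E) && (e \notin H))); last first.
  move=> H; rewrite !powersetE !inE eqxx andbT finset.subUset finset.sub1set eE /=.
  congr andb; apply/eqP/idP => [<-|eH]; first by rewrite !inE eqxx.
  by rewrite finset.setU1K.
rewrite -big_split /=; apply: eq_bigr => H /andP[_ eH].
rewrite !wE finset.setU11 (negbTE eH) -(fe (e |: H)) finset.setU1K //.
have -> : g (e |: H) = g H.
  by apply: eq_bigr => e'; rewrite !inE => /andP[/negbTE->].
by ring.
Qed.

(** Independence: the hypothesis on [f] says that it ignores the edges of [F], which are removed one
    at a time. *)
Lemma expect_avoid f F : F \subset E -> (forall H, f (H :\: F) = f H) ->
  expect (fun H => f H * [disjoint H & F]%:R) = expect f * (1 - p) ^+ #|F|.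
Proof.
have [k] := ubnP #|F|; elim: k => // k IHk in f F *; rewrite ltnS => Fk FE fF.
have [->|/finset.set0Pn[e eF]] := eqVneq F finset.set0.
  rewrite cards0 expr0 mulr1; apply: eq_expect => H.
  by rewrite -finset.setI_eq0 finset.setI0 eqxx mulr1.
pose F' := F :\ e; have FE' : F = e |: F' by rewrite finset.setD1K.
have cF : #|F| = #|F'|.+1 by rewrite (cardsD1 e) eF.
have eF' : e \notin F' by rewrite !inE eqxx.
have F'E : F' \subset E by apply: fintype.subset_trans FE; exact: finset.subsetDl.
have f_e H : f (H :\ e) = f H.
  by rewrite -fF -[RHS]fF finset.setDDl FE' finset.setUA finset.setUid.
have f_F' H : f (H :\: F') = f H.
  by rewrite -fF -[RHS]fF finset.setDDl FE' finset.setUCA finset.setUid.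
rewrite cF exprSr mulrA -IHk //; last by rewrite -ltnS -cF.
rewrite -(@expect_avoid1 (fun H => f H * [disjoint H & F']%:R) e).
- apply: eq_expect => H; rewrite -mulrA -natrM mulnb FE'.
  rewrite -disjoints1 -!finset.setI_eq0 finset.setIUr finset.setU_eq0 andbC.
  by rewrite (finset.setIC [set e]).
- exact: (fintype.subsetP FE).
- move=> H; rewrite f_e; congr (_ * _%:R).
  rewrite -!finset.setI_eq0; congr ((_ == _) : bool).
  by apply/setP => z; rewrite !inE; case: eqP => //= ->; rewrite andbF.
Qed.

End Expectation.

(** * Union bounds for isolated connected sets *)

Section UnionBound.
Context {R : realType}.
Variable n : nat.
Notation V := 'I_(3 ^ n).
Notation edges := {set {set V}}.
Implicit Types (x y : V) (i j : 'I_n) (d : 'I_3) (S : {set V}) (I : {set 'I_n})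
  (H : edges).

Lemma cut_sub I S : cut I S \subset cube_edges n.
Proof.
apply/fintype.subsetP => e /cutP[x [i [d [xS iI yS ->]]]].
apply/imsetP; exists (x, set_digit x i d); rewrite // inE /=.
apply/cube_adjP; exists i, d => //.
by apply: set_digit_neq; apply: contraNneq yS => ->.
Qed.

(** The direction of an edge is the only digit in which its ends differ, so cuts in disjoint sets of
    directions share no edge. *)
Lemma cut_disjoint I (J : {set 'I_n}) S S' :
  [disjoint I & J] -> [disjoint cut I S & cut J S'].
Proof.
move=> IJ; apply/pred0Pn => -[e /andP[/= /cutP[x [i [d [xS iI yS ->]]]]]].
case/cutP => [x' [j [d' [xS' jJ yS']]]].
have yx : set_digit x i d != x by apply: contraNneq yS => ->.
have ij : i != j by apply: contraTneq iI => ->; rewrite (disjointFl IJ).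
case/set2_eq => [[xx yy]|[xx yy]].
  by subst x'; have [ij'] := set_digit_inj yx yy; rewrite ij' eqxx in ij.
have /esym xE := set_digitK x' j d'; rewrite -xx -yy in xE.
have xy : set_digit x j (digit (set_digit x i d) j) = set_digit x i d by rewrite -xE.
by have [ij'] := set_digit_inj yx (esym xy); rewrite ij' eqxx in ij.
Qed.

Lemma disjoint_setDl (T : finType) (A B C : {set T}) :
  [disjoint B & C] -> [disjoint A :\: B & C] = [disjoint A & C].
Proof.
move=> BC; rewrite -!finset.setI_eq0; congr ((_ == _) : bool).
apply/setP => z; rewrite !inE; case: (boolP (z \in C)); last by rewrite !andbF.
by move=> zC; rewrite (disjointFl BC zC).
Qed.

Definition open_edge i H : rel V := fun x y =>
  [&& [set x; y] \in H, y != x & [exists j, (j != i) && (y == set_digit x j (digit y j))]].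

Lemma open_edge_sym i H : symmetric (open_edge i H).
Proof.
move=> x y; rewrite /open_edge finset.setUC eq_sym; congr [&& _, _ & _].
apply: eq_existsb => j; congr (_ && _); apply/eqP/eqP => [yE|xE].
  by rewrite yE set_digitK.
by rewrite xE set_digitK.
Qed.

(** This turns being a union of components, once direction [i] is deleted, into an event about
    absent edges, to which independence applies. *)
Lemma closedE i H S :
  [forall x in S, forall y, open_edge i H x y ==> (y \in S)] =
  [disjoint H & cut [set~ i] S].
Proof.
apply/idP/idP => [Scl|HS].
  apply/pred0Pn => -[e /andP[/= eH /cutP[x [j [d [xS ji yS eE]]]]]].
  have /implyP := forallP (forall_inP Scl x xS) (set_digit x j d).
  rewrite (negbTE yS) => F; suff: false by []; apply: F; rewrite /open_edge -eE eH /=.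
  apply/andP; split; first by apply: contraNneq yS => ->.
  by apply/existsP; exists j; rewrite digit_set eqxx -finset.in_setC1 ji eqxx.
apply/forall_inP => x xS; apply/forallP => y; apply/implyP.
case/and3P => xyH yx /existsP[j /andP[ji /eqP yE]].
apply: contraTT HS => yS; apply/pred0Pn; exists [set x; y]; rewrite /= xyH /=.
by apply/cutP; exists x, j, (digit y j); rewrite -yE inE inE ji.
Qed.

Definition small_sets a M : {set {set V}} :=
  [set S : {set V} | [&& induced_connected S, a <= #|S| & #|S| <= M]%N].

(** A member need not be a single component of the open graph, so this may overcount small
    components; in return, its expected size is a plain sum of cut probabilities. *)
Definition small_closed i M H : {set {set V}} :=
  [set S in small_sets 1 M | [disjoint H & cut [set~ i] S]].

Lemma component_small i M H C : C \in components (open_edge i H) -> (#|C| <= M)%N ->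
  C \in small_closed i M H.
Proof.
have osym := open_edge_sym i H.
case/imsetP => x _ -> CM; rewrite !inE CM andbT -andbA; apply/and3P; split.
- apply/forall_inP => y yC; apply/forall_inP => z zC.
  have /connectP[p] : connect (open_edge i H) y z.
    by move: zC; rewrite -(component_eq osym yC) inE.
  elim: p {zC} y yC => [|u p IHp] y yC /=; first by move=> _ ->; exact: connect0.
  case/andP => yu up zE.
  have uC : u \in component (open_edge i H) x.
    by rewrite -(component_eq osym yC) inE connect1.
  apply: (connect_trans (connect1 _) (IHp u uC up zE)) => /=.
  rewrite yC uC /=; case/and3P: yu => _ uy /existsP[j /andP[_ /eqP uE]].
  apply/cube_adjP; exists j, (digit u j) => //.
  by apply: set_digit_neq; rewrite -uE.
- by apply/card_gt0P; exists x; rewrite inE connect0.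
rewrite -closedE; apply/forall_inP => y yC; apply/forallP => z; apply/implyP => yz.
by rewrite -(component_eq osym yC) inE connect1.
Qed.

(** There are at most [m] components beyond the small ones, because [m * M] is the number of
    vertices. *)
Lemma card_closed i M H m : (0 < M)%N -> (3 ^ n = m * M)%N ->
  (#|[set S : {set V} | [disjoint H & cut [set~ i] S]]| <=
     2 ^ (#|small_closed i M H| + m))%N.
Proof.
move=> M0 NE; have osym := open_edge_sym i H.
have := card_closed_sets (open_edge i H).
rewrite (_ : [set S : {set V} | [forall x in S, _]] =
  [set S : {set V} | [disjoint H & cut [set~ i] S]]); last first.
  by apply/setP => S; rewrite !inE closedE.
move=> /leq_trans; apply; rewrite leq_exp2l // -(leq_pmul2r M0).
apply: (leq_trans (card_components osym M)).
rewrite mulnDl leq_add //; last by rewrite card_ord NE.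
rewrite leq_mul2r; apply/orP; right.
apply/subset_leq_card/fintype.subsetP => C; rewrite inE => /andP[].
exact: component_small.
Qed.

Variable p : R.
Hypothesis p01 : 0 <= p <= 1.
Notation Ex := (expect (cube_edges n) p).

Lemma cube_probE A : cube_prob p A = Ex (fun H => `[< A H >]%:R).
Proof.
rewrite /cube_prob big_mkcondr; apply: eq_bigr => H _.
by case: `[< A H >]; rewrite ?mulr1 ?mulr0.
Qed.

Lemma expect_cst c : Ex (fun=> c) = c.
Proof.
have := cube_prob_supset p (finset.sub0set (cube_edges n)).
rewrite cards0 expr0 cube_probE => E1.
rewrite -[RHS]mulr1 -E1 -expectZ; apply: eq_expect => H.
by rewrite asboolT ?mulr1 // finset.sub0set.
Qed.

Lemma expect_cut I S : Ex (fun H => [disjoint H & cut I S]%:R) = (1 - p) ^+ #|cut I S|.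
Proof.
have := @expect_avoid R _ _ p (fun=> 1) _ (cut_sub I S) (fun=> erefl).
rewrite expect_cst mul1r => <-.
by apply: eq_expect => H; rewrite mul1r.
Qed.

Lemma expect_small_closed i M :
  Ex (fun H => #|small_closed i M H|%:R) =
  \sum_(S in small_sets 1 M) (1 - p) ^+ #|cut [set~ i] S|.
Proof.
rewrite -(eq_bigr _ (fun S _ => expect_cut [set~ i] S)) -expect_sum.
apply: eq_expect => H; rewrite -sum1_card natr_sum big_mkcond [RHS]big_mkcond /=.
by apply: eq_bigr => S _; rewrite inE; case: (S \in _) => //=; case: ifP.
Qed.

(** The first indicator depends only on edges outside direction [i], the second only on edges along
    [i]; independence therefore extracts [(1 - p) ^+ L] for each [S]. *)
Lemma expect_closed_large i M m k L : (0 < M)%N -> (3 ^ n = m * M)%N ->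
  Ex (fun H => \sum_(S | (L <= #|cut [set i] S|)%N)
        ((#|small_closed i M H| <= k)%N && [disjoint H & cut [set~ i] S])%:R *
        [disjoint H & cut [set i] S]%:R) <= 2 ^+ (k + m) * (1 - p) ^+ L.
Proof.
move=> M0 NE; have /andP[p0 p1] := p01.
have q0 : 0 <= 1 - p by rewrite subr_ge0.
pose f S H : R := ((#|small_closed i M H| <= k)%N && [disjoint H & cut [set~ i] S])%:R.
have dij : [disjoint [set i] & [set~ i]].
  by rewrite finset.disjoints_subset finset.setCK.
have fI S S' H : f S (H :\: cut [set i] S') = f S H.
  have dis S'' : [disjoint H :\: cut [set i] S' & cut [set~ i] S''] =
                 [disjoint H & cut [set~ i] S''].
    by rewrite disjoint_setDl // cut_disjoint.
  rewrite /f dis; congr ((_ && _)%:R); congr ((_ <= _)%N); apply: eq_card => C.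
  by rewrite !inE dis.
rewrite expect_sum.
apply: (@le_trans _ _ (\sum_(S | (L <= #|cut [set i] S|)%N) Ex (f S) * (1 - p) ^+ L)).
  apply: ler_sum => S LS; rewrite -/(f S) expect_avoid ?cut_sub //;
    last by move=> H; exact: fI.
  apply: ler_wpM2l.
    by rewrite -(expect_cst 0); apply: expect_le => // H _; rewrite ler0n.
  by rewrite ler_wiXn2l // lerBlDl lerDr.
(* What remains counts closed sets, and only when there are at most [k] small ones. *)
rewrite -mulr_suml ler_wpM2r ?exprn_ge0 // -expect_sum.
rewrite -(expect_cst (2 ^+ (k + m))); apply: expect_le => // H _.
have [Hk|Hk] := leqP #|small_closed i M H| k; last first.
  by rewrite big1 ?exprn_ge0 // => S _; rewrite /f leqNgt Hk.
apply: (@le_trans _ _ #|[set S : {set V} | [disjoint H & cut [set~ i] S]]|%:R).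
  rewrite -sum1_card natr_sum /= big_mkcond [leRHS]big_mkcond /=.
  apply: ler_sum => S _; rewrite /f Hk inE /=; case: ifP => // _.
    by case: ifP.
  by case: ifP.
rewrite -natrX ler_nat; apply: (leq_trans (card_closed _ _ M0 NE)).
by rewrite leq_exp2l // leq_add2r.
Qed.

(** The indicator of the event is dominated pointwise. A set of size at most [M] appears in the
    first sum. For a larger one choose a direction [i] with a big cut: either more than [k] small
    closed sets exist, which Markov's inequality controls, or the set is counted by [g i H]. *)
Lemma cube_prob_isolated_le M m k L : (0 < M)%N -> (3 ^ n = m * M)%N -> (0 < k)%N ->
  (forall S, (M < #|S|)%N -> (2 * #|S| <= 3 ^ n)%N ->
     exists i, (L <= #|cut [set i] S|)%N) ->
  cube_prob p (fun H => exists S, [/\ induced_connected S, (2 <= #|S|)%N,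
     (2 * #|S| <= 3 ^ n)%N & forall x y, x \in S -> y \notin S -> [set x; y] \notin H]) <=
  \sum_(S in small_sets 2 M) (1 - p) ^+ #|cut [set: 'I_n]%SET S| +
  \sum_(i < n) ((\sum_(S in small_sets 1 M) (1 - p) ^+ #|cut [set~ i] S|) / k%:R +
    2 ^+ (k + m) * (1 - p) ^+ L).
Proof.
move=> M0 NE k0 large.
rewrite -(eq_bigr _ (fun S _ => expect_cut [set: 'I_n]%SET S)) -expect_sum cube_probE.
pose g i H : R := \sum_(S | (L <= #|cut [set i] S|)%N)
        ((#|small_closed i M H| <= k)%N && [disjoint H & cut [set~ i] S])%:R *
        [disjoint H & cut [set i] S]%:R.
apply: (@le_trans _ _ (Ex (fun H =>
  \sum_(S in small_sets 2 M) [disjoint H & cut [set: 'I_n]%SET S]%:R +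
  \sum_(i < n) (k%:R^-1 * #|small_closed i M H|%:R + g i H)))); last first.
  rewrite expectD lerD2l expect_sum; apply: ler_sum => i _.
  rewrite expectD expectZ expect_small_closed mulrC lerD2l.
  exact: expect_closed_large.
have g0 i H : 0 <= g i H by apply: sumr_ge0 => S _; rewrite mulr_ge0 ?ler0n.
apply: expect_le => // H HE; case: asboolP => [[S [Sconn S2 SN HS]]|_] /=; last first.
  by apply: addr_ge0; apply: sumr_ge0 => i _;
    rewrite ?ler0n // addr_ge0 ?mulr_ge0 ?invr_ge0 ?ler0n.
have disS I : [disjoint H & cut I S].
  apply/pred0Pn => -[e /andP[/= eH /cutP[x [i [d [xS _ yS eE]]]]]].
  by have := HS _ _ xS yS; rewrite -eE eH.
have [SM|SM] := leqP #|S| M.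
  rewrite (bigD1 S) /=; last by rewrite inE Sconn S2.
  rewrite disS -addrA lerDl; apply: addr_ge0; apply: sumr_ge0 => i _; rewrite ?ler0n //.
  by rewrite addr_ge0 ?mulr_ge0 ?invr_ge0 ?ler0n.
have [i Li] := large S SM SN.
rewrite (bigD1 i) //= addrA addrAC; apply: ler_wpDl.
  by apply: addr_ge0; apply: sumr_ge0 => j _;
    rewrite ?ler0n // addr_ge0 ?mulr_ge0 ?invr_ge0 ?ler0n.
have [Hk|Hk] := leqP #|small_closed i M H| k.
  apply: ler_wpDl; first by rewrite mulr_ge0 ?invr_ge0 ?ler0n.
  rewrite /g (bigD1 S) //= Hk !disS mulr1 lerDl.
  by apply: sumr_ge0 => S' _; rewrite mulr_ge0 ?ler0n.
(* Here the count exceeds [k], so the Markov term alone is at least 1. *)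
apply: ler_wpDr => //.
by rewrite mulrC ler_pdivlMr ?ltr0n // mul1r ler_nat ltnW.
Qed.

End UnionBound.

(** * Comparing powers of [n] with powers of 3 *)

Section Numerics.
Local Open Scope nat_scope.

(** With [t = n %/ 60], [n <= 60 (t + 1) <= 3 ^ t], and the 20th power has exponent [20 t <= n / 3].
    The middle inequality needs [t >= 6], hence 360. *)
Lemma exp20_le n : 360 <= n -> n ^ 20 <= 3 ^ (n %/ 3).
Proof.
move=> n360; set t := n %/ 60.
have t6 : 6 <= t by rewrite leq_divRL.
have nt : n <= 60 * t.+1 by rewrite mulnC ltnW // ltn_ceil.
have tle : 60 * t.+1 <= 3 ^ t.
  rewrite -(subnK t6); elim: (t - 6) => [|k IHk] //.
  by rewrite addSn expnS; lia.
apply: (@leq_trans ((3 ^ t) ^ 20)); first by rewrite leq_exp2r // (leq_trans nt).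
by rewrite -expnM leq_exp2l // leq_divRL // -mulnA /t leq_trunc_div.
Qed.

Lemma exp3_le_cube n : 3 ^ n <= 9 * (3 ^ (n %/ 3)) ^ 3.
Proof.
rewrite {1}(divn_eq n 3) expnD mulnC -expnM leq_mul2r orbC.
by have := ltn_pmod n (isT : 0 < 3); case: (n %% 3) => [|[|[|]]].
Qed.

End Numerics.

(** * Sums of cut probabilities over connected sets *)

Section Estimates.
Context {R : realType}.
Variables (n : nat) (q : R).
Hypotheses (n0 : (0 < n)%N) (q0 : 0 <= q) (q1 : q <= 1).
Hypothesis hq : (3 * q ^+ 2) ^+ n <= n%:R ^+ 2.
Notation V := 'I_(3 ^ n).
Implicit Types (S : {set V}) (I : {set 'I_n}).

(** If [3 q^2 <= 1] its powers are at most 1; otherwise they increase with the exponent, so the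
    hypothesis at exponent [n] covers every [j <= n]. *)
Lemma expr_double_le j : (j <= n)%N -> q ^+ (2 * j) <= n%:R ^+ 2 / 3 ^+ j.
Proof.
move=> jn; rewrite ler_pdivlMr ?exprn_gt0 // exprM -exprMn mulrC.
have r0 : 0 <= 3 * q ^+ 2 by rewrite mulr_ge0 // exprn_ge0.
have [r1|r1] := leP (3 * q ^+ 2) 1.
  apply: (@le_trans _ _ 1); first exact: exprn_ile1.
  by rewrite exprn_ege1 // ler1n.
by apply: le_trans hq; apply: ler_weXn2l => //; apply: ltW.
Qed.

(** Asking only for [n - 1] directions serves both the whole cube and the cube with one direction
    deleted. *)
Lemma card_cut_ge a I S : (n.-1 <= #|I|)%N -> (0 < #|S| <= 3 ^ a)%N ->
  (2 * (n.-1 - a) * #|S| <= #|cut I S|)%N.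
Proof.
move=> nI /andP[S0 Sa].
have l3 : 0 < ln 3 :> R by rewrite ln_gt0 // ltr1n.
have := @edge_isoperimetry R n I S.
have lnS : ln #|S|%:R <= a%:R * ln 3 :> R.
  by rewrite mulr_natl -lnXn // ler_ln ?posrE ?ltr0n ?exprn_gt0 // -natrX ler_nat.
have nI' : (n.-1)%:R <= #|I|%:R :> R by rewrite ler_nat.
(* When [a >= n - 1], truncated subtraction makes the lower bound 0. *)
have [na|an] := leqP n.-1 a; first by rewrite (eqP na).
move=> iso; rewrite -(ler_nat R) -(ler_pM2r l3); apply: le_trans iso.
have key : (n.-1%:R - a%:R) * ln 3 <= #|I|%:R * ln 3 - ln #|S|%:R :> R.
  by rewrite mulrBl; apply: lerB => //; rewrite ler_wpM2r // ltW.
have s2 : 0 <= 2 * #|S|%:R :> R by rewrite mulr_ge0.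
have := ler_wpM2l s2 key; rewrite !natrM natrB 1?ltnW //; lra.
Qed.

Lemma connected_sum_le a s I : (n.-1 <= #|I|)%N -> (0 < s <= 3 ^ a)%N ->
  \sum_(S in connected_sets n s) q ^+ #|cut I S| <=
    3 ^+ n * (n%:R * 3) ^+ (s.-1).*2 * (n%:R ^+ 2 / 3 ^+ (n.-1 - a)) ^+ s.
Proof.
move=> nI sa; set c := (_ / _) ^+ s.
have c0 : 0 <= c by rewrite exprn_ge0 // divr_ge0 ?exprn_ge0.
apply: (@le_trans _ _ (\sum_(S in connected_sets n s) c)).
  apply: ler_sum => S; rewrite inE => /andP[/eqP Ss _].
  apply: (@le_trans _ _ (q ^+ (2 * (n.-1 - a) * s))).
    by rewrite ler_wiXn2l // -{1}Ss card_cut_ge // Ss.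
  rewrite exprM lerXn2r ?nnegrE ?exprn_ge0 ?divr_ge0 ?exprn_ge0 //.
  by apply: expr_double_le; lia.
rewrite sumr_const -[leLHS]mulr_natl ler_wpM2r // -natrM -!natrX -natrM ler_nat.
by apply: card_connected_sets; case/andP: sa.
Qed.

Lemma sum_small_sets a M (F : {set V} -> R) :
  \sum_(S in small_sets n a M) F S =
  \sum_(a <= s < M.+1) \sum_(S in connected_sets n s) F S.
Proof.
rewrite big_geq_mkord (partition_big (fun S : {set V} => inord #|S| : 'I_M.+1)
  (fun s => a <= s)%N) /=; last first.
  by move=> S; rewrite inE => /and3P[_ aS SM]; rewrite inordK.
apply: eq_bigr => s sa; apply: eq_bigl => S; rewrite !inE -val_eqE /=.
apply/idP/idP => [/andP[/and3P[-> _ SM]]|/andP[/eqP Ss ->]]; first by rewrite inordK // => ->.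
by rewrite Ss sa -ltnS ltn_ord inord_val eqxx.
Qed.

Lemma sum_single_le I : (n.-1 <= #|I|)%N ->
  \sum_(S in connected_sets n 1) q ^+ #|cut I S| <= 3 * n%:R ^+ 2.
Proof.
move=> nI; apply: (le_trans (connected_sum_le (a := 0) nI _)) => //.
rewrite expr0 mulr1 subn0 expr1 -{1}(prednK n0) exprS.
rewrite le_eqVlt; apply/orP; left; apply/eqP; field.
by rewrite expf_neq0.
Qed.

(** Enlarging the walk count to [(3n)^(2s)] turns the bound into a geometric term in [s]. *)
Lemma connected_sum_le_pow a s I : (n.-1 <= #|I|)%N -> (0 < s <= 3 ^ a)%N ->
  \sum_(S in connected_sets n s) q ^+ #|cut I S| <=
    3 ^+ n * (9 * n%:R ^+ 4 / 3 ^+ (n.-1 - a)) ^+ s.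
Proof.
move=> nI sa; apply: (le_trans (connected_sum_le nI sa)); rewrite -mulrA.
have [s0 _] := andP sa; have n1 : 1 <= n%:R :> R by rewrite ler1n.
rewrite ler_wpM2l ?exprn_ge0 //.
have -> : 9 * n%:R ^+ 4 / 3 ^+ (n.-1 - a) =
    (n%:R * 3) ^+ 2 * (n%:R ^+ 2 / 3 ^+ (n.-1 - a)) :> R.
  by ring.
rewrite [leRHS]exprMn ler_wpM2r ?exprn_ge0 ?divr_ge0 ?exprn_ge0 // -exprM.
by apply: ler_weXn2l; [lra | lia].
Qed.

Hypothesis n360 : (360 <= n)%N.

Lemma expr20_le : n%:R ^+ 20 <= 3 ^+ (n %/ 3) :> R.
Proof. by rewrite -!natrX ler_nat exp20_le. Qed.

Lemma expr3_le_cube : 3 ^+ n <= 9 * (3 ^+ (n %/ 3)) ^+ 3 :> R.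
Proof. by rewrite -!natrX -natrM ler_nat exp3_le_cube. Qed.

(** Sizes 2 to 9 use the sharp value [a = 2]; from size 10 on the crude [a = n - h] is enough,
    because the power of the small ratio beats the number of sets. Each range contributes at most
    [1 / n]. *)
Lemma sum_medium_le I : (n.-1 <= #|I|)%N ->
  \sum_(S in small_sets n 2 (3 ^ (n - n %/ 3))) q ^+ #|cut I S| <= 2 / n%:R.
Proof.
set h := (n %/ 3)%N; set M := (3 ^ (n - h))%N.
pose y : R := 3 ^+ h; pose N : R := 3 ^+ n.
have ny : n%:R ^+ 20 <= y by exact: expr20_le.
have Ny : N <= 9 * y ^+ 3 by exact: expr3_le_cube.
have yN : y <= N by rewrite ler_weXn2l ?ler1n // leq_div.
move=> nI; have x0 : 360 <= n%:R :> R by rewrite ler_nat.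
have y0 : 0 < y by rewrite exprn_gt0.
have N0 : 0 < N by rewrite exprn_gt0.
have xp k : 0 < n%:R ^+ k :> R by rewrite exprn_gt0 //; lra.
have xle k k' : (k <= k')%N -> n%:R ^+ k <= n%:R ^+ k' :> R.
  by apply: ler_weXn2l; lra.
(* As [w <= 1], the exponent drops to the least size of the range; the constant 27 is absorbed by
   one more factor [n]. *)
have pow_small (z w : R) k s : (k <= s)%N -> 0 <= z -> 27 * z <= w -> w <= 1 ->
    (27 * z) ^+ s <= w ^+ k.
  move=> ks z0 zw w1; have z0' : 0 <= 27 * z by rewrite mulr_ge0.
  apply: (@le_trans _ _ ((27 * z) ^+ k)).
    by apply: ler_wiXn2l => //; apply: le_trans w1.
  by rewrite lerXn2r // nnegrE // (le_trans z0').
have hn : (h <= n)%N by rewrite leq_div.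
have h0 : (0 < h)%N by rewrite divn_gt0 //; lia.
rewrite sum_small_sets (@big_cat_nat _ _ _ 10) //=; last first.
  by rewrite ltnS (leq_trans (_ : 9 <= 3 ^ 2)%N) // leq_exp2l //; lia.
have -> : 2 / n%:R = n%:R^-1 + n%:R^-1 :> R by lra.
apply: lerD.
  apply: (@le_trans _ _ (\sum_(2 <= s < 10) n%:R ^- 10)); last first.
    rewrite big_const_nat iter_addr_0 -[leLHS]mulr_natl /=.
    rewrite ler_pdivrMr //.
    have -> : n%:R^-1 * n%:R ^+ 10 = n%:R ^+ 9 :> R by field; lra.
    by rewrite (_ : (10 - 2)%N = 8%N) //; apply: le_trans (xle 1%N 9%N isT); rewrite expr1; lra.
  apply: ler_sum_nat => s /andP[s2 s10].
  have sa : (0 < s <= 3 ^ 2)%N by lia.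
  apply: (le_trans (connected_sum_le_pow nI sa)).
  have -> : (9 * n%:R ^+ 4 / 3 ^+ (n.-1 - 2)) = 27 * (9 * n%:R ^+ 4 / N) :> R.
    have -> : N = 3 ^+ (n.-1 - 2) * 27.
      by rewrite /N (_ : 27 = 3 ^+ 3) -?exprD; [congr (_ ^+ _); lia | ring].
    by field; rewrite expf_neq0.
  have xN : n%:R ^+ 20 <= N by apply: le_trans ny yN.
  (* This equals [n^10 / N], which is at most [n^(-10)] by [n^20 <= N]. *)
  apply: (@le_trans _ _ (N * (n%:R ^+ 5 / N) ^+ 2)).
    rewrite ler_wpM2l ?(ltW N0) // pow_small // ?divr_ge0 ?(ltW N0) ?mulr_ge0 ?(ltW (xp _)) //.
      rewrite mulrA ler_pM2r ?invr_gt0 // exprS [27 * _]mulrA.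
      by rewrite ler_wpM2r ?(ltW (xp _)) //; lra.
    by rewrite ler_pdivrMr // mul1r; apply: le_trans xN; apply: xle.
  rewrite (_ : N * _ = n%:R ^+ 10 / N); last by field; lra.
  rewrite ler_pdivrMr // ler_pdivlMl //.
  by rewrite -exprD.
apply: (@le_trans _ _ (\sum_(10 <= s < M.+1) (n%:R * N)^-1)); last first.
  rewrite big_const_nat iter_addr_0 -[leLHS]mulr_natl.
  rewrite invfM mulrCA ler_piMr ?invr_ge0 //.
  rewrite ler_pdivrMr // mul1r /N -natrX ler_nat.
  have : (M <= 3 ^ n)%N by rewrite leq_exp2l // leq_subr.
  lia.
apply: ler_sum_nat => s /andP[s10 sM].
have sa : (0 < s <= 3 ^ (n - h))%N by apply/andP; split; [lia | exact: sM].
apply: (le_trans (connected_sum_le_pow nI sa)).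
have -> : (9 * n%:R ^+ 4 / 3 ^+ (n.-1 - (n - h))) = 27 * (n%:R ^+ 4 / y) :> R.
  have -> : y = 3 ^+ (n.-1 - (n - h)) * 3.
    by rewrite /y -exprSr; congr (_ ^+ _); lia.
  by field; rewrite expf_neq0.
(* Clearing denominators leaves [N^2 n^51 <= y^10], which splits into [N^2 <= 81 y^6] and
   [81 n^51 <= n^80 <= y^4]. *)
apply: (@le_trans _ _ (N * (n%:R ^+ 5 / y) ^+ 10)).
  rewrite ler_wpM2l ?(ltW N0) // pow_small // ?divr_ge0 ?(ltW y0) ?(ltW (xp _)) //.
    rewrite mulrA ler_pM2r ?invr_gt0 // exprS.
    by rewrite ler_wpM2r ?(ltW (xp _)) //; lra.
  by rewrite ler_pdivrMr // mul1r; apply: le_trans ny; apply: xle.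
rewrite -[leRHS]mul1r ler_pdivlMr; last by rewrite mulr_gt0 //; lra.
rewrite [leLHS](_ : _ = N ^+ 2 * n%:R ^+ 51 / y ^+ 10); last first.
  by field; lra.
rewrite ler_pdivrMr ?exprn_gt0 // mul1r.
have N2 : N ^+ 2 <= 81 * y ^+ 6.
  have -> : 81 * y ^+ 6 = (9 * y ^+ 3) ^+ 2 by ring.
  by rewrite lerXn2r ?nnegrE ?Ny ?(ltW N0) // mulr_ge0 // exprn_ge0 // ltW.
have y4 : 81 * n%:R ^+ 51 <= y ^+ 4.
  apply: (@le_trans _ _ (n%:R ^+ 80)).
    apply: le_trans (xle 52%N 80%N isT); rewrite exprS ler_wpM2r ?(ltW (xp _)) //; lra.
  by rewrite (exprM _ 20 4) lerXn2r ?nnegrE ?ny ?(ltW y0) ?(ltW (xp _)).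
rewrite (_ : y ^+ 10 = y ^+ 6 * y ^+ 4); last by rewrite -exprD.
apply: (@le_trans _ _ (81 * y ^+ 6 * n%:R ^+ 51)).
  by rewrite ler_wpM2r ?(ltW (xp _)).
rewrite mulrAC mulrC ler_wpM2l ?exprn_ge0 ?(ltW y0) //.
Qed.
End Estimates.

(** * The explicit bound [8 / n] *)

Section Bound.
Context {R : realType}.
Variables (n : nat) (p : R).
Hypothesis p01 : 0 <= p <= 1.
Hypothesis hq : (3 * (1 - p) ^+ 2) ^+ n <= n%:R ^+ 2.
Hypothesis n360 : (360 <= n)%N.
Notation V := 'I_(3 ^ n).
Implicit Types S : {set V}.

Lemma sum_card_cut S : (\sum_i #|cut [set i] S| = #|cut [set: 'I_n]%SET S|)%N.
Proof.
apply/eqP; rewrite -(eqn_add2r (\sum_i stays i S)) -big_split /=.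
have := card_cut [set: 'I_n]%SET S; rewrite cardsT card_ord => cutT.
have -> : (\sum_i stays i S = \sum_(i in [set: 'I_n]%SET) stays i S)%N.
  by apply: eq_bigl => i; rewrite inE.
rewrite cutT -[n in (n * _)%N]card_ord -sum_nat_const; apply/eqP/eq_bigr => i _.
by have := card_cut [set i] S; rewrite cards1 mul1n big_set1.
Qed.

(** For at most half of the vertices, [n - log_3 |S| >= log_3 2 >= 1/2], so the cut has at least
    [|S| > M] edges; then average over the [n] directions. *)
Lemma large_cut M S : (M < #|S|)%N -> (2 * #|S| <= 3 ^ n)%N ->
  exists i : 'I_n, (M %/ n <= #|cut [set i] S|)%N.
Proof.
move=> MS SN; have n0 : (0 < n)%N by lia.
have S0 : (0 < #|S|)%N by lia.
have l3 : 0 < ln 3 :> R by rewrite ln_gt0 // ltr1n.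
have l2 : 0 < ln 2 :> R by rewrite ln_gt0 // ltr1n.
have l32 : ln 3 <= 2 * ln 2 :> R.
  by rewrite mulr_natl -lnXn // ler_ln ?posrE; lra.
have SR : 0 < #|S|%:R :> R by rewrite ltr0n.
have iso := @edge_isoperimetry R n [set: 'I_n]%SET S.
rewrite cardsT card_ord in iso.
have lnS : ln 2 + ln #|S|%:R <= n%:R * ln 3 :> R.
  rewrite -lnM ?posrE // [leRHS]mulr_natl -lnXn // ler_ln ?posrE ?exprn_gt0 ?mulr_gt0 //.
  by rewrite -natrM -natrX ler_nat.
have cutS : (#|S| <= #|cut [set: 'I_n]%SET S|)%N.
  rewrite -(ler_nat R) -(ler_pM2r l3); apply: le_trans iso.
  rewrite [2 * _]mulrC -mulrA ler_wpM2l ?ler0n //; lra.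
apply/existsP; apply: contraLR cutS; rewrite negb_exists => /forallP small.
rewrite -ltnNge -sum_card_cut.
apply: (@leq_ltn_trans (\sum_(i < n) (M %/ n))%N).
  by apply: leq_sum => i _; rewrite ltnW // ltnNge.
rewrite sum_nat_const card_ord mulnC; apply: leq_ltn_trans MS.
exact: leq_trunc_div.
Qed.

(** Otherwise [3 (1 - p)^2 >= 27/16], whose cube exceeds 3, so its [n]-th power is at least
    [3 ^ (n %/ 3) >= n^20], against the bound [n^2]. The value [3/4] is chosen because its cube is
    below [1/2]. *)
Lemma one_sub_le : 1 - p <= 3 / 4.
Proof.
have x0 : 360 <= n%:R :> R by rewrite ler_nat.
rewrite leNgt; apply/negP => q34; have [p0 p1] := andP p01.
have q0 : 0 <= 1 - p by lra.
have h3 : (n %/ 3 * 3 <= n)%N by apply: leq_trunc_div.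
have r : 27 / 16 <= 3 * (1 - p) ^+ 2.
  have : (3 / 4) ^+ 2 <= (1 - p) ^+ 2 by rewrite lerXn2r ?nnegrE; lra.
  lra.
have : n%:R ^+ 20 <= n%:R ^+ 2 :> R.
  apply: le_trans hq; apply: (le_trans (expr20_le n360)).
  apply: (@le_trans _ _ ((3 * (1 - p) ^+ 2) ^+ (3 * (n %/ 3)))).
    rewrite exprM lerXn2r ?nnegrE ?exprn_ge0 ?mulr_ge0 ?sqr_ge0 //.
    have : (27 / 16) ^+ 3 <= (3 * (1 - p) ^+ 2) ^+ 3.
      by rewrite lerXn2r ?nnegrE //; lra.
    lra.
  by apply: ler_weXn2l; [lra | lia].
by rewrite leNgt ltr_eXn2l //; lra.
Qed.

Lemma cube_prob_isolated_bound :
  cube_prob p (fun H => exists S, [/\ induced_connected S, (2 <= #|S|)%N,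
     (2 * #|S| <= 3 ^ n)%N & forall x y, x \in S -> y \notin S -> [set x; y] \notin H])
  <= 8 / n%:R.
Proof.
have [p0 p1] := andP p01.
have q0 : 0 <= 1 - p by lra.
have q1 : 1 - p <= 1 by lra.
have n0 : (0 < n)%N by lia.
have x0 : 360 <= n%:R :> R by rewrite ler_nat.
set h := (n %/ 3)%N; set M := (3 ^ (n - h))%N.
have hn : (h <= n)%N by rewrite leq_div.
have M0 : (0 < M)%N by rewrite expn_gt0.
have NE : (3 ^ n = 3 ^ h * M)%N by rewrite -expnD subnKC.
have k0 : (0 < n ^ 4)%N by rewrite expn_gt0 n0.
have y20 : (n ^ 20 <= 3 ^ h)%N by rewrite exp20_le.
have medium (I : {set 'I_n}) : (n.-1 <= #|I|)%N ->
    \sum_(S in small_sets n 2 M) (1 - p) ^+ #|cut I S| <= 2 / n%:R.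
  exact: sum_medium_le.
(* Singletons account for the term [3 n^2]; this is why Markov's inequality is applied with the
   threshold [n^4]. *)
have all_small i : \sum_(S in small_sets n 1 M) (1 - p) ^+ #|cut [set~ i] S| <=
    3 * n%:R ^+ 2 + 2 / n%:R.
  have cI : (n.-1 <= #|[set~ i]|)%N by rewrite cardsC1 card_ord.
  rewrite sum_small_sets big_ltn // -sum_small_sets.
  by apply: lerD; [exact: sum_single_le | exact: medium].
apply: (le_trans (cube_prob_isolated_le p01 M0 NE k0 (@large_cut M))).
(* Three missing edges cost a factor at most [1/2], so [M %/ n >= 3 (k + 3^h)] leaves at most
   [2^(-3^h)]. *)
have tail : 2 ^+ (n ^ 4 + 3 ^ h) * (1 - p) ^+ (M %/ n) <= n%:R ^- 20.
  set k := (n ^ 4 + 3 ^ h)%N.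
  (* As [n^4 <= 3^h], the left side is at most [9 * 3^h]; multiplied by [n] it is at most [3^(2h)],
     and [2h <= n - h]. *)
  have L : (3 * (k + 3 ^ h) <= M %/ n)%N.
    rewrite leq_divRL // /k.
    have n4 : (n ^ 4 <= 3 ^ h)%N by apply: leq_trans y20; rewrite leq_pexp2l.
    have n2 : (n * 9 <= 3 ^ h)%N.
      apply: leq_trans y20; rewrite expnS leq_mul2l; apply/orP; right.
      by apply: (@leq_trans (n ^ 1)); rewrite ?leq_pexp2l // expn1; lia.
    apply: (@leq_trans (3 ^ h * 3 ^ h)).
      apply: (@leq_trans (3 ^ h * (n * 9))); last by rewrite leq_mul2l n2 orbT.
      by set y := (3 ^ h)%N in n4 *; nia.
    by rewrite -expnD leq_exp2l // /h; lia.
  have q3 : (1 - p) ^+ 3 <= 2^-1.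
    apply: (@le_trans _ _ ((3 / 4) ^+ 3)); last lra.
    by rewrite lerXn2r ?nnegrE ?one_sub_le //; lra.
  apply: (@le_trans _ _ (2 ^+ k * (2^-1) ^+ (k + 3 ^ h))).
    rewrite ler_wpM2l ?exprn_ge0 //.
    apply: (@le_trans _ _ ((1 - p) ^+ (3 * (k + 3 ^ h)))); first exact: ler_wiXn2l.
    by rewrite exprM lerXn2r ?nnegrE ?exprn_ge0 // invr_ge0.
  rewrite exprD mulrA -exprMn divff // expr1n mul1r exprVn.
  rewrite lef_pV2 ?posrE ?exprn_gt0 //; last lra.
  by rewrite -!natrX ler_nat; apply: (leq_trans y20); apply/ltnW/ltn_expl.
(* Each direction costs at most [5 n^2 / n^4] for Markov and [n^(-2)] for the tail. *)
apply: (@le_trans _ _ (2 / n%:R + \sum_(i < n) (6 / n%:R ^+ 2))).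
  apply: lerD; first by apply: medium; rewrite cardsT card_ord leq_pred.
  apply: ler_sum => i _.
  have x2 : 0 < n%:R^-1 :> R by rewrite invr_gt0; lra.
  have x3 : n%:R^-1 <= 1 :> R by rewrite invf_le1; lra.
  have -> : 6 / n%:R ^+ 2 = (5 * n%:R ^+ 2) / (n ^ 4)%:R + n%:R ^- 2 :> R.
    by rewrite natrX; field; lra.
  apply: lerD; last first.
    apply: (le_trans tail); rewrite -!exprVn; apply: ler_wiXn2l => //; exact: ltW.
  rewrite ler_wpM2r ?invr_ge0 ?ler0n //; apply: (le_trans (all_small i)).
  have : 1 <= n%:R ^+ 2 :> R by rewrite exprn_ege1 //; lra.
  lra.
rewrite sumr_const card_ord -[_ *+ n]mulr_natl le_eqVlt; apply/orP; left.
by apply/eqP; field; lra.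
Qed.

End Bound.

(** * From the hypothesis on [p] to the limit *)

(** The hypothesis gives [3 q^2 <= r^2] with [r^n = ln n], so the [n]-th power is at most
    [(ln n)^2 <= n^2]. *)
Lemma ln_root_bound (R : realType) (n : nat) (q : R) : (0 < n)%N -> 0 <= q ->
  q <= 1 / Num.sqrt 3 * ln (n%:R : R) `^ (1 / n%:R) ->
  (3 * q ^+ 2) ^+ n <= n%:R ^+ 2.
Proof.
move=> n0 q0 hq; set r := _ `^ _ in hq.
have n1 : 1 <= n%:R :> R by rewrite ler1n.
have nR : n%:R != 0 :> R by rewrite pnatr_eq0 -lt0n.
have r0 : 0 <= r by exact: powR_ge0.
have s3 : 0 < Num.sqrt 3 :> R by rewrite sqrtr_gt0.
have l0 : 0 <= ln n%:R :> R by rewrite ln_ge0.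
have rn : r ^+ n = ln n%:R.
  by rewrite -powR_mulrn // -powRrM div1r mulVf // powRr1.
have qr : 3 * q ^+ 2 <= r ^+ 2.
  have : q ^+ 2 <= (1 / Num.sqrt 3 * r) ^+ 2.
    by rewrite lerXn2r ?nnegrE // mulr_ge0 // divr_ge0 // ltW.
  by rewrite exprMn expr_div_n expr1n sqr_sqrtr //; lra.
apply: (@le_trans _ _ ((r ^+ 2) ^+ n)).
  by rewrite lerXn2r ?nnegrE ?exprn_ge0 // mulr_ge0 // exprn_ge0.
rewrite exprAC rn lerXn2r ?nnegrE //.
have := @le_ln1Dx R (n%:R - 1); rewrite addrCA subrr addr0 => le_ln.
by apply: le_trans (le_ln _) _; lra.
Qed.

Unset Implicit Arguments.
Local Open Scope classical_set_scope.
Local Open Scope ring_scope.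

Theorem theorem13 (R : realType) (p : nat -> R)
    (hp01 : forall n : nat, (0 < n)%N -> 0 <= p n <= 1)
    (hp : forall n : nat, (0 < n)%N ->
      1 - 1 / Num.sqrt 3 * ln (n%:R : R) `^ (1 / n%:R) <= p n) :
  (fun n : nat => cube_prob (p n)
    [set H : {set {set 'I_(3 ^ n)}} |
      exists (s : nat) (S : {set 'I_(3 ^ n)}),
        [/\ (2 <= s)%N, s%:R <= 3 ^+ n / 2 :> R, S \in connected_sets n s &
            forall x y : 'I_(3 ^ n), x \in S -> y \notin S ->
              [set x; y]%SET \notin H]]) @ \oo --> (0 : R).
Proof.
apply/cvgrPdist_le => e e0.
(* From 360 on the bound [8 / n] holds, and beyond [8 / e] it is at most [e]. *)
exists (maxn 360 (Num.truncn (8 / e)).+1) => // n /=; rewrite geq_max => /andP[n360 ne].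
have n0 : (0 < n)%N by apply: leq_trans n360.
have nR : 0 < n%:R :> R by rewrite ltr0n.
have p01 := hp01 n n0; have [p0 p1] := andP p01.
have hq : (3 * (1 - p n) ^+ 2) ^+ n <= n%:R ^+ 2.
  by apply: ln_root_bound => //; have := hp n n0; lra.
rewrite sub0r normrN ger0_norm; last first.
  rewrite cube_probE -(expect_cst n (p n) 0).
  by apply: expect_le => // H _; rewrite ler0n.
apply: (@le_trans _ _ (8 / n%:R)); last first.
  rewrite ler_pdivrMr // mulrC -ler_pdivrMr //.
  by apply: (le_trans (ltW (truncnS_gt _))); rewrite ler_nat.
apply: le_trans (cube_prob_isolated_bound p01 hq n360).
(* Inclusion of events: [s] is the cardinality of [S], and the real bound [3^n / 2] becomes
   [2 * #|S| <= 3 ^ n] in the naturals. *)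
rewrite !cube_probE; apply: expect_le => // H _; rewrite ler_nat.
case: asboolP => // -[s [S [s2 sN + HS]]]; rewrite inE => /andP[/eqP Ss Sconn].
rewrite asboolT //; exists S; split; rewrite ?Ss //.
by rewrite -(ler_nat R) natrM natrX; lra.
Qed.
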